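(* Let $n\ge 1$, let $f:\mathbb{R}^n\to\mathbb{R}$ be a smooth convex function and let $M\subset\mathbb{E}^{n+1}$ be its graph. For $p=(x,f(x))\in M$ put $W(p)=\sqrt{1+|\nabla f(x)|^2}$. For $k>0$, let $\Psi$ be the tangent hyperplane of $M$ at $p$, let $\Phi$ be the hyperplane through $(x,f(x)+k)$ parallel to $\Psi$, and let $S_p^*(k)$ denote the $n$-dimensional surface area of the part of $M$ lying between the hyperplanes $\Phi$ and $\Psi$. Then $M$ does not satisfy the following condition $(S^* )$: there is a nonnegative function $\eta$ of $k$ alone such that $S_p^*(k)/W(p)=\eta(k)$ for all $p\in M$ and all $k>0$.
   Context: $\nabla f$ denotes the gradient of $f$. *)

(* Defs.v *)
From HB Require Import structures.
From mathcomp Require Import all_boot all_order all_algebra.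
From mathcomp Require Import all_classical all_reals all_analysis.
Set Implicit Arguments. Unset Strict Implicit. Unset Printing Implicit Defensive.
Import Order.TTheory GRing.Theory Num.Theory.
Import numFieldNormedType.Exports.
Local Open Scope classical_set_scope.
Local Open Scope ring_scope.

Section Defs.
Variables (R : realType) (n : nat).
Implicit Types (f : 'rV[R]_n -> R) (x z v : 'rV[R]_n).

Definition iterD (vs : seq 'rV[R]_n) f : 'rV[R]_n -> R :=
  foldr (fun v g => fun y => 'D_v g y) f vs.

Definition smooth f : Prop :=
  forall (vs : seq 'rV[R]_n) x, differentiable (iterD vs f) x.

Definition convex_fun f : Prop :=
  forall x z (t : R), 0 <= t <= 1 ->
    f ((1 - t) *: x + t *: z) <= (1 - t) * f x + t * f z.

Definition grad f x : 'rV[R]_n := \row_i 'D_(delta_mx 0 i) f x.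

Definition dotv (u w : 'rV[R]_n) : R := \sum_i u 0 i * w 0 i.

Definition Wfun f x : R := Num.sqrt (1 + dotv (grad f x) (grad f x)).

Definition upd x (k : nat) (t : R) : 'rV[R]_n :=
  \row_j (if (j : nat) == k then t else x 0 j).

Fixpoint iint (k : nat) (F : 'rV[R]_n -> \bar R) (x : 'rV[R]_n) : \bar R :=
  match k with
  | 0 => F x
  | k.+1 => (\int[lebesgue_measure]_(t in [set: R]) iint k F (upd x k t))%E
  end.

(* n-dimensional Lebesgue integral over R^n (of a nonnegative function) *)
Definition integral_Rn (F : 'rV[R]_n -> \bar R) : \bar R := iint n F 0.

(* S_p^*(k): area of the part of the graph between the tangent hyperplane
   Psi at p = (x, f x) and the parallel hyperplane Phi through (x, f x + k).
   The point (z, f z) lies between them iff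
   0 <= f z - (f x + grad f x . (z - x)) <= k. *)
Definition Sstar f x (k : R) : \bar R :=
  integral_Rn (fun z =>
    (if (0 <= f z - (f x + dotv (grad f x) (z - x)) <= k)
     then Wfun f z else 0)%:E).

End Defs.

(* Main.v *)
(** Suppose (S-star) holds, write W = sqrt (1 + |grad f|^2), and let
    gap x z = f z - f x - grad f x . (z - x) be the height of the graph above
    the tangent hyperplane at x, so that the integral of W over the convex
    sublevel set {gap x <= k} equals eta(k) W(x).  This is finite, so every
    sublevel set is bounded, whence gap x grows at least linearly and f attains
    every gradient close to grad f x.

    Either some q <> 0 is such that every multiple of |q . (z - x)| is dominated
    by gap x z / 4 up to a constant, or such a direction does not exist.

    In the first case all slopes grad f x + t q are attained, say at x_t, and
    {gap x_t <= k} lies in {gap x <= 2k} for large k.  As W(x_t) is as large as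
    we please, eta(2k) >= 2^(n+1) eta(k) for large k.  This contradicts
    eta(k) = O(k^n), which holds because the sublevel set lies in a cube of
    side O(k) and the partial derivatives of the convex function gap x have
    total variation at most 2k on each line.

    In the second case, limits of normalized points where domination fails
    yield directions u with grad f . u bounded above, enough of them to span
    the space; hence grad f . w <= C for all w in a ball around some v <> 0.
    Then the sets {gap x <= 1} contain cubes whose size depends only on a bound
    for |grad f x|, while their volume is at most eta(1) W(x).  So they have
    bounded diameter, and from any slope p one reaches p + tau v with tau fixed
    as long as slopes stay bounded.  Iterating contradicts grad f . v <= C. *)
Require Import Defs.
From HB Require Import structures.
From mathcomp Require Import all_boot all_order all_algebra.
From mathcomp Require Import all_classical all_reals all_analysis.
From mathcomp Require Import measurable_realfun ring lra.
Import Order.TTheory GRing.Theory Num.Theory.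
Import numFieldNormedType.Exports.
Local Open Scope ring_scope.

Set Implicit Arguments.
Unset Strict Implicit.

(** * Iterated integrals *)

Section IteratedIntegral.
Local Open Scope classical_set_scope.
Context {R : realType} {n : nat}.
Implicit Types (x z c : 'rV[R]_n) (F G : 'rV[R]_n -> \bar R).

(* Joint measurability, stated through test maps so that no sigma-algebra
   has to be put on ['rV[R]_n]. *)
Definition coord_measurable F := forall d (T : measurableType d)
    (phi : T -> 'rV[R]_n),
  (forall i, measurable_fun setT (fun t => phi t 0 i)) ->
  measurable_fun setT (F \o phi).

Lemma updE x k t j : upd x k t 0 j = if (j : nat) == k then t else x 0 j.
Proof. by rewrite mxE. Qed.

Lemma measurable_upd x k j : measurable_fun setT (fun t : R => upd x k t 0 j).
Proof.
under eq_fun do rewrite updE.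
by case: eqP => _; [exact: measurable_id|exact: measurable_cst].
Qed.

Lemma coord_measurable_upd F x k : coord_measurable F ->
  measurable_fun setT (fun t : R => F (upd x k t)).
Proof. by move=> mF; apply: mF => j; exact: measurable_upd. Qed.

Lemma iint_ge0 k F x : (forall z, 0 <= F z)%E -> (0 <= iint k F x)%E.
Proof. by move=> F0; elim: k x => //= k IH x; apply: integral_ge0. Qed.

Lemma measurable_upd2 d (T : measurableType d) (phi : T -> 'rV[R]_n) k :
  (forall i, measurable_fun setT (fun t => phi t 0 i)) ->
  forall i, measurable_fun setT (fun p : T * R => upd (phi p.1) k p.2 0 i).
Proof.
move=> mphi i; under eq_fun do rewrite updE.
case: eqP => _; first exact: measurable_snd.
exact: (measurableT_comp (mphi i) (@measurable_fst _ _ T R)).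
Qed.

(** Test maps are closed under adjoining the integration variable: [T * R] is again a test space, so
    Tonelli's measurability of parametric integrals applies at each step. *)
Lemma coord_measurable_iint k F : (forall z, 0 <= F z)%E ->
  coord_measurable F -> coord_measurable (iint k F).
Proof.
move=> F0 mF; elim: k => //= k IH d T phi mphi.
pose G (p : T * R) := iint k F (upd (phi p.1) k p.2).
apply: (measurable_fun_fubini_tonelli_F (m2 := lebesgue_measure) G).
  exact: (IH _ _ _ (measurable_upd2 k mphi)).
by move=> p; exact: iint_ge0.
Qed.

Lemma measurable_iint_upd k F x i : (forall z, 0 <= F z)%E ->
  coord_measurable F -> measurable_fun setT (fun t : R => iint k F (upd x i t)).
Proof.
by move=> F0 mF; apply: coord_measurable_upd; exact: coord_measurable_iint.
Qed.

Lemma iint_le k F G x : (forall z, 0 <= F z)%E ->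
  coord_measurable F -> coord_measurable G ->
  (forall z, F z <= G z)%E -> (iint k F x <= iint k G x)%E.
Proof.
move=> F0 mF mG FG; elim: k x => //= k IH x.
have G0 z : (0 <= G z)%E by exact: le_trans (FG z).
apply: ge0_le_integral => //.
- by move=> t _; exact: iint_ge0.
- exact: measurable_iint_upd.
- exact: measurable_iint_upd.
Qed.

Lemma coord_measurableD F G : coord_measurable F -> coord_measurable G ->
  coord_measurable (fun z => F z + G z)%E.
Proof.
move=> mF mG d T phi mphi.
by apply: emeasurable_funD; [exact: mF|exact: mG].
Qed.

Lemma iintD k F G x : (forall z, 0 <= F z)%E -> (forall z, 0 <= G z)%E ->
  coord_measurable F -> coord_measurable G ->
  iint k (fun z => F z + G z)%E x = (iint k F x + iint k G x)%E.
Proof.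
move=> F0 G0 mF mG; elim: k x => //= k IH x.
under eq_integral do rewrite IH.
apply: ge0_integralD => //.
- by move=> t _; exact: iint_ge0.
- exact: measurable_iint_upd.
- by move=> t _; exact: iint_ge0.
- exact: measurable_iint_upd.
Qed.

Lemma coord_measurable_cst (a : \bar R) : coord_measurable (fun=> a).
Proof. by move=> d T phi _; exact: measurable_cst. Qed.

Lemma coord_measurable_sum I (s : seq I) (F : I -> 'rV[R]_n -> \bar R) :
  (forall m, coord_measurable (F m)) ->
  coord_measurable (fun z => \sum_(m <- s) F m z)%E.
Proof.
move=> mF; elim: s => [|m s IH].
  by under eq_fun do rewrite big_nil; exact: coord_measurable_cst.
by under eq_fun do rewrite big_cons; exact: coord_measurableD.
Qed.

Lemma iint_sum k I (s : seq I) (F : I -> 'rV[R]_n -> \bar R) x :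
  (forall m z, 0 <= F m z)%E -> (forall m, coord_measurable (F m)) ->
  (iint k (fun z => \sum_(m <- s) F m z) x = \sum_(m <- s) iint k (F m) x)%E.
Proof.
move=> F0 mF; elim: s => [|m s IH].
  rewrite big_nil; under eq_fun do rewrite big_nil.
  by elim: k x => //= k IH x; under eq_integral do rewrite IH; exact: integral0.
under eq_fun do rewrite big_cons.
rewrite iintD ?IH ?big_cons//.
- by move=> z; apply: sume_ge0.
- exact: coord_measurable_sum.
Qed.

Lemma iintZ k (a : R) F x : 0 <= a -> (forall z, 0 <= F z)%E ->
  coord_measurable F -> iint k (fun z => a%:E * F z)%E x = (a%:E * iint k F x)%E.
Proof.
move=> a0 F0 mF; elim: k x => //= k IH x.
under eq_integral do rewrite IH.
apply: ge0_integralZl_EFin => //.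
- by move=> t _; exact: iint_ge0.
- exact: measurable_iint_upd.
Qed.

(** Coordinate [i] is none of the first [k], so its update commutes with theirs and Tonelli moves
    its integral past one coordinate at a time. *)
Lemma iint_upd k i F x : (forall z, 0 <= F z)%E -> coord_measurable F ->
  (k <= i)%N ->
  (\int[lebesgue_measure]_t iint k F (upd x i t) =
   iint k (fun z => \int[lebesgue_measure]_t F (upd z i t)) x)%E.
Proof.
move=> F0 mF; elim: k x => //= k IH x ki.
under [RHS]eq_integral do rewrite -IH 1?ltnW//.
have updC s t : upd (upd x i t) k s = upd (upd x k s) i t.
  apply/rowP => j; rewrite !updE; case: (eqVneq (j : nat) k) => // ->.
  by rewrite ltn_eqF.
under [RHS]eq_integral do under eq_integral do rewrite -updC.
apply: (fubini_tonelli (m1 := lebesgue_measure) (m2 := lebesgue_measure)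
  (fun p : R * R => iint k F (upd (upd x i p.1) k p.2))).
  exact: (coord_measurable_iint k F0 mF (measurable_upd2 k (measurable_upd x i))).
by move=> p; exact: iint_ge0.
Qed.

Lemma coord_measurable_slice F i : (forall z, 0 <= F z)%E ->
  coord_measurable F ->
  coord_measurable (fun z => \int[lebesgue_measure]_t F (upd z i t))%E.
Proof.
move=> F0 mF d T phi mphi.
pose G (p : T * R) := F (upd (phi p.1) i p.2).
apply: (measurable_fun_fubini_tonelli_F (m2 := lebesgue_measure) G).
  exact: (mF _ _ _ (measurable_upd2 i mphi)).
by move=> p; exact: F0.
Qed.

(* By Tonelli any coordinate can be integrated first. *)
Lemma iint_le_slice k i F G x : (forall z, 0 <= F z)%E -> (forall z, 0 <= G z)%E ->
  coord_measurable F -> coord_measurable G -> (i < k)%N ->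
  (forall z, \int[lebesgue_measure]_t F (upd z i t) <=
             \int[lebesgue_measure]_t G (upd z i t))%E ->
  (iint k F x <= iint k G x)%E.
Proof.
move=> F0 G0 mF mG + FG; elim: k x => //= k IH x; rewrite ltnS leq_eqVlt.
have mI := measurable_iint_upd; case/predU1P => [<-|ik].
  rewrite !iint_upd//; apply: iint_le => //.
  - by move=> z; apply: integral_ge0.
  - exact: coord_measurable_slice.
  - exact: coord_measurable_slice.
apply: ge0_le_integral => //.
- by move=> t _; exact: iint_ge0.
- exact: mI.
- exact: mI.
- by move=> t _; exact: IH.
Qed.

(** An open set is a countable union of balls with rational centres and radii [1/(m+1)]. In the sup
    norm a ball is a finite intersection of coordinate conditions. *)
Lemma measurable_continuous_coord d (T : measurableType d)
    (phi : T -> 'rV[R]_n) (f : 'rV[R]_n -> R) :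
  (forall i, measurable_fun setT (fun t => phi t 0 i)) -> continuous f ->
  measurable_fun setT (f \o phi).
Proof.
move=> mphi cf; apply: (measurability _ (RGenOpens.measurableE R)).
move=> _ [_ [a [b ->] <-]]; rewrite setTI comp_preimage.
set U := f @^-1` _.
have oU : open U by move/continuousP: cf; apply; exact: interval_open.
pose Q := ('rV[rat]_n * nat)%type.
pose cen (q : Q) := map_mx (ratr : rat -> R) q.1.
pose rad (q : Q) := q.2.+1%:R^-1 : R.
have rad0 q : 0 < rad q by rewrite invr_gt0.
have -> : phi @^-1` U = \bigcup_(q : Q) (if `[< ball (cen q) (rad q) `<=` U >]
    then phi @^-1` ball (cen q) (rad q) else set0).
  apply/seteqP; split => [t Ut|t [q _]]; last first.
    by case: ifPn => // /asboolP; apply.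
  have /nbhs_ballP[e /= e0 eU] := open_nbhs_nbhs (conj oU Ut).
  (* The factor 2 lets a ball of this radius, whose centre is within the same radius of [phi t], fit
     into the [e]-ball around [phi t]. *)
  have [m me] : exists m : nat, 2 * m.+1%:R^-1 < e.
    have e20 : 0 < e / 2 by rewrite divr_gt0.
    have := @near_infty_natSinv_lt R (PosNum e20) => -[m _ /(_ m (leqnn m))] /= me.
    by exists m; rewrite mulrC -ltr_pdivlMr.
  have m0 : (0 : R) < m.+1%:R^-1 by rewrite invr_gt0.
  pose s : R := m.+1%:R^-1; rewrite -/s in me m0.
  have /choice[q Hq] : forall j : 'I_n, exists q : rat,
      `|phi t 0 j - ratr q| < s.
    move=> j; have /rat_in_itvoo[q] : phi t 0 j - s < phi t 0 j + s.
      by rewrite ltrD2l; lra.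
    rewrite in_itv/= => /andP[h1 h2]; exists q.
    by rewrite ltr_norml; apply/andP; split; lra.
  pose p : Q := (\row_j q j, m).
  have pt : ball (cen p) (rad p) (phi t).
    by split => // i j; rewrite /ball/= ord1 !mxE distrC; exact: Hq.
  exists p => //; case: ifPn => // /asboolP; case=> z pz; apply: eU.
  apply: (@le_ball _ _ _ (rad p + rad p)); first by have -> : rad p = s by []; lra.
  by apply: (@ball_triangle _ _ (cen p)) pz; exact: ball_sym.
apply: countable_bigcupT_measurable; first exact: countableP.
move=> q; case: ifPn => // _.
have -> : phi @^-1` ball (cen q) (rad q) =
    \bigcap_(j in [set: 'I_n]) [set t | `|cen q 0 j - phi t 0 j| < rad q].
  apply/seteqP; split => [t [_ +] j _|t ht]; first by move/(_ 0 j).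
  by split => // i j; rewrite ord1; exact: ht.
apply: fin_bigcap_measurable => // j _.
have := measurable_fun_ltr (measurableT_comp (@normr_measurable R setT)
  (measurable_funB (@measurable_cst _ _ _ _ setT (cen q 0 j)) (mphi j)))
  (@measurable_cst _ _ _ _ setT (rad q)).
move=> /(_ measurableT [set true] Logic.I); rewrite setTI.
congr measurable; apply/seteqP; split => t /=.
Qed.

Lemma coord_measurable_if_le (g h : 'rV[R]_n -> R) (a : R) :
  continuous g -> continuous h ->
  coord_measurable (fun z => (if g z <= a then h z else 0)%:E).
Proof.
move=> cg ch d T phi mphi; apply/measurable_EFinP.
apply: (@measurable_fun_ifT _ _ _ _ (h \o phi) (cst 0) (fun t => g (phi t) <= a)).
- apply: measurable_fun_ler; last exact: measurable_cst.
  exact: measurable_continuous_coord.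
- exact: measurable_continuous_coord.
- exact: measurable_cst.
Qed.

Lemma integral_segment (a r v : R) : 0 <= r -> 0 <= v ->
  (\int[lebesgue_measure]_t (if `|t - a| <= r then v else 0)%:E = (2 * r * v)%:E)%E.
Proof.
move=> r0 v0.
under eq_integral => t _.
  rewrite (_ : (if _ then _ else _)%:E = (v%:E * (\1_(`[(a - r), (a + r)]%classic : set R) t)%:E)%E).
    over.
  rewrite indicE mem_setE in_itv/= ler_distl.
  by case: ifP; rewrite -EFinM ?mulr1 ?mulr0.
rewrite ge0_integralZl_EFin//; last exact/measurable_EFinP.
rewrite integral_indic// setIT [X in (_ * X)%E](lebesgue_measure_itv `[(a - r), (a + r)]%R)/= lte_fin.
case: ltP => [_|]; first by rewrite -EFinB -EFinM; congr EFin; ring.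
by move=> ra; rewrite (_ : r = 0); [rewrite mule0 mulr0 mul0r|lra].
Qed.

Lemma rV_norm_le x (r : R) : 0 <= r -> (`|x| <= r) = [forall j, `|x 0 j| <= r].
Proof.
move=> r0; rewrite -[`|x|]/(mx_norm x) mx_normrE; apply/bigmax_leP/forallP => [[_ h] j|h].
  exact: (h (0, j)).
by split=> // -[i j] _ /=; rewrite ord1.
Qed.

(** For the induction, the constraint on the coordinates not yet integrated is kept as an
    indicator. *)
Lemma iint_cube k c r x : 0 <= r -> (k <= n)%N ->
  iint k (fun z => (if `|z - c| <= r then 1 else 0)%:E) x =
  (if [forall j : 'I_n, (k <= j)%N ==> (`|x 0 j - c 0 j| <= r)]
   then (2 * r) ^+ k else 0)%:E.
Proof.
move=> r0; elim: k x => [|k IH] x kn /=.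
  rewrite rV_norm_le//; congr (if _ then _ else _)%:E.
  by apply: eq_forallb => j; rewrite !mxE.
under eq_integral do rewrite IH 1?ltnW//.
pose b := [forall j : 'I_n, (k < j)%N ==> (`|x 0 j - c 0 j| <= r)].
pose k' := Ordinal kn.
under eq_integral => t _.
  rewrite (_ : [forall j, _] = (`|t - c 0 k'| <= r) && b); first over.
  apply/forallP/andP => [h|[h1 /forallP h2] j].
    split; first by have := h k'; rewrite leqnn/= updE eqxx.
    apply/forallP => j; apply/implyP => kj; have := h j.
    by rewrite ltnW//= updE gtn_eqF.
  apply/implyP; rewrite leq_eqVlt updE; case: eqVneq => [kj _|].
    by rewrite (_ : j = k')//; apply: val_inj.
  by move=> _ /= kj; exact: (implyP (h2 j) kj).
rewrite -/b; case: b => /=.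
  under eq_integral do rewrite andbT.
  by rewrite integral_segment ?exprn_ge0 ?mulr_ge0// exprS.
by under eq_integral do rewrite andbF; rewrite integral0.
Qed.

Lemma continuous_dist c : continuous (fun z : 'rV[R]_n => `|z - c|).
Proof. by move=> z; exact: (cvg_norm (cvgB (@cvg_id _ (nbhs z)) (cvg_cst c))). Qed.

Lemma coord_measurable_cube_cst c (r v : R) :
  coord_measurable (fun z : 'rV[R]_n => (if `|z - c| <= r then v else 0)%:E).
Proof.
apply: (@coord_measurable_if_le (fun z => `|z - c|) (fun=> v)).
  exact: continuous_dist.
exact: cst_continuous.
Qed.

Lemma iint_cube_cst c (r v : R) x : 0 <= r -> 0 <= v ->
  iint n (fun z => (if `|z - c| <= r then v else 0)%:E) x = (v * (2 * r) ^+ n)%:E.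
Proof.
move=> r0 v0; have -> : (fun z => (if `|z - c| <= r then v else 0)%:E) =
    (fun z => v%:E * (if `|z - c| <= r then 1 else 0)%:E)%E.
  by apply/funext => z; case: ifP => _; rewrite -EFinM ?mulr1 ?mulr0.
rewrite iintZ ?iint_cube//.
- by rewrite ifT//; apply/forallP => j; rewrite leqNgt ltn_ord.
- by move=> z; rewrite lee_fin; case: ifP.
- exact: coord_measurable_cube_cst.
Qed.

End IteratedIntegral.

(** * The dot product and its bounds in the sup norm *)

Section Dot.
Context {R : realType} {n : nat}.
Implicit Types (u v w p q : 'rV[R]_n).

Lemma dotvC u v : dotv u v = dotv v u.
Proof. by apply: eq_bigr => i _; rewrite mulrC. Qed.

Lemma dotvDr u v w : dotv u (v + w) = dotv u v + dotv u w.
Proof. by rewrite -big_split; apply: eq_bigr => i _; rewrite mxE mulrDr. Qed.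

Lemma dotvZr u a v : dotv u (a *: v) = a * dotv u v.
Proof. by rewrite mulr_sumr; apply: eq_bigr => i _; rewrite mxE mulrCA. Qed.

Lemma dotvNr u v : dotv u (- v) = - dotv u v.
Proof. by rewrite -scaleN1r dotvZr mulN1r. Qed.

Lemma dotvBr u v w : dotv u (v - w) = dotv u v - dotv u w.
Proof. by rewrite dotvDr dotvNr. Qed.

Lemma dotv0r u : dotv u 0 = 0.
Proof. by rewrite -(subrr 0) dotvBr subrr. Qed.

Lemma dotvDl u v w : dotv (u + v) w = dotv u w + dotv v w.
Proof. by rewrite !(dotvC _ w) dotvDr. Qed.

Lemma dotvZl a u v : dotv (a *: u) v = a * dotv u v.
Proof. by rewrite !(dotvC _ v) dotvZr. Qed.

Lemma dotvNl u v : dotv (- u) v = - dotv u v.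
Proof. by rewrite !(dotvC _ v) dotvNr. Qed.

Lemma dotvBl u v w : dotv (u - v) w = dotv u w - dotv v w.
Proof. by rewrite !(dotvC _ w) dotvBr. Qed.

Lemma dotv_delta u i : dotv u (delta_mx 0 i) = u 0 i.
Proof.
rewrite /dotv (bigD1 i)//= mxE !eqxx mulr1 big1 ?addr0// => j ji.
by rewrite mxE (negPf ji) andbF mulr0.
Qed.

Lemma coord_le_norm v j : `|v 0 j| <= `|v|.
Proof. by have := lexx `|v|; rewrite {1}rV_norm_le// => /forallP. Qed.

Lemma normr_dotv u v : `|dotv u v| <= n%:R * (`|u| * `|v|).
Proof.
apply: le_trans (ler_norm_sum _ _ _) _.
rewrite -[n in n%:R]card_ord mulr_natl -sumr_const ler_sum// => i _.
by rewrite normrM ler_pM// coord_le_norm.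
Qed.

Lemma dotv_le u v : dotv u v <= n%:R * (`|u| * `|v|).
Proof. exact: le_trans (ler_norm _) (normr_dotv u v). Qed.

Lemma dotvv_gt0 q : q != 0 -> 0 < dotv q q.
Proof.
move=> q0; have [i qi] : exists i, q 0 i != 0.
  apply/existsP; apply: contraNT q0; rewrite negb_exists => /forallP h.
  by apply/eqP/rowP => i; rewrite mxE; have := h i; rewrite negbK => /eqP.
rewrite /dotv (bigD1 i)//= ltr_pwDl//; last by apply: sumr_ge0 => j _; rewrite -expr2 sqr_ge0.
by rewrite -expr2 exprn_even_gt0.
Qed.

Lemma dotvv_ge0 q : 0 <= dotv q q.
Proof. by apply: sumr_ge0 => i _; rewrite -expr2 sqr_ge0. Qed.

Lemma continuous_dotv u : continuous (dotv u).
Proof.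
apply: continuous_big => [|i _ x]; first exact: add_continuous.
exact: (cvgM (cvg_cst (u 0 i)) (@coord_continuous _ _ _ 0 i x)).
Qed.

End Dot.

Lemma continuous_dotv_dist {R : realType} {n : nat} (p c : 'rV[R]_n) :
  continuous (fun z : 'rV[R]_n => dotv p (z - c)).
Proof.
under eq_fun do rewrite dotvBr.
by move=> z; exact: (cvgB (@continuous_dotv _ _ p z) (cvg_cst _)).
Qed.

(** * Volume of long convex sets *)

Section LongConvex.
Context {R : realType} {n : nat}.
Implicit Types (x y z a : 'rV[R]_n).

(* The convex hull of a cube and of a distant point contains many disjoint
   cubes of half the size, strung along the segment from the centre. *)
Lemma iint_long_convex (F : 'rV[R]_n -> \bar R) (D : 'rV[R]_n -> Prop)
    a y x (r : R) (N : nat) :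
  coord_measurable F -> (forall z, 0 <= F z)%E -> (forall z, D z -> 1 <= F z)%E ->
  (forall u v t, 0 <= t <= 1 -> D u -> D v -> D ((1 - t) *: u + t *: v)) ->
  0 < r -> (forall z, `|z - a| <= r -> D z) -> D y ->
  2 * N%:R * r < `|y - a| ->
  ((N%:R * r ^+ n)%:E <= iint n F x)%E.
Proof.
move=> mF F0 DF Dconv r0 Da Dy Nr.
have [->|N0] := posnP N; first by rewrite mul0r; exact: iint_ge0.
have N0' : (0 : R) < N%:R by rewrite ltr0n.
(* The centres stay on the half of the segment nearer to [a], where shrinking towards [y] keeps at
   least half the size of the cube. Consecutive centres are more than [r] apart, so the half-size
   cubes are disjoint. *)
pose th (m : nat) : R := m%:R / (2 * N%:R).
pose c m := a + th m *: (y - a).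
pose G m z : \bar R := (if `|z - c m| <= r / 2 then 1 else 0)%:E.
have G0 m z : (0 <= G m z)%E by rewrite lee_fin; case: ifP.
have mG m : coord_measurable (G m) by exact: coord_measurable_cube_cst.
have GD m z : (m < N)%N -> `|z - c m| <= r / 2 -> D z.
  move=> mN zc; have t0 : 0 <= th m by rewrite divr_ge0// mulr_ge0// ltW.
  have t1 : th m <= 2^-1.
    rewrite ler_pdivrMr ?mulr_gt0// mulrA mulVf ?mul1r ?pnatr_eq0//.
    by rewrite ler_nat ltnW.
  have t1' : 0 < 1 - th m by lra.
  have -> : z = (1 - th m) *: (a + (1 - th m)^-1 *: (z - c m)) + th m *: y.
    rewrite scalerDr scalerA divff ?gt_eqF// scale1r /c.
    apply/rowP => j; rewrite !mxE; ring.
  apply: Dconv => //; first by apply/andP; split=> //; lra.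
  apply: Da; rewrite (addrC a) addrK normrZ ger0_norm ?invr_ge0 ?(ltW t1')//.
  rewrite ler_pdivrMl// mulrC; apply: le_trans zc _.
  by rewrite ler_pM2l//; lra.
have Gdisj m m' z : `|z - c m| <= r / 2 -> `|z - c m'| <= r / 2 -> m = m'.
  move=> h1 h2; have : `|c m - c m'| <= r.
    rewrite (splitr r) (_ : _ - _ = (z - c m') - (z - c m)); last first.
      by rewrite opprB [RHS]addrC addrA subrK.
    by apply: le_trans (ler_normB _ _) _; exact: lerD.
  rewrite /c opprD addrACA subrr add0r -scalerBl normrZ -mulrBl normrM.
  rewrite (@ger0_norm _ (_^-1)) ?invr_ge0 ?mulr_ge0 ?(ltW N0')//.
  case: (eqVneq m m') => // mm' h; exfalso.
  have m1 : 1 <= `|m%:R - m'%:R| :> R.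
    have -> : m%:R - m'%:R = (m%:Z - m'%:Z)%:~R :> R by rewrite intrB.
    by rewrite -intr_norm ler1z -gtz0_ge1 normr_gt0 subr_eq0.
  have : r < (2 * N%:R)^-1 * `|y - a|.
    by rewrite ltr_pdivlMl ?mulr_gt0.
  have : (2 * N%:R)^-1 * `|y - a| <= r.
    apply: le_trans h; rewrite -mulrA; exact: ler_peMl.
  lra.
have sumF z : (\sum_(m < N) G m z <= F z)%E.
  case: (pselect (exists m : 'I_N, `|z - c m| <= r / 2)) => [[m zm]|no].
    rewrite (bigD1 m)//= big1 ?adde0.
      by rewrite /G zm; apply: DF; exact: GD zm.
    move=> i im; rewrite /G ifF//; apply: contraNF im => zi.
    by apply/eqP/val_inj; exact: Gdisj zi zm.
  rewrite big1// => m _; rewrite /G ifF//; apply/negP => zm; apply: no.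
  by exists m.
apply: le_trans (iint_le n x _ _ _ sumF); last 3 first.
- by move=> z; apply: sume_ge0.
- exact: (@coord_measurable_sum _ _ _ _ (fun m : 'I_N => G m)).
- exact: mF.
rewrite (@iint_sum _ _ _ _ _ (fun m : 'I_N => G m))//.
under eq_bigr do rewrite iint_cube_cst ?divr_ge0 ?(ltW r0)// mul1r.
rewrite sumEFin lee_fin sumr_const card_ord mulr_natl.
by rewrite (_ : 2 * (r / 2) = r)//; field.
Qed.

End LongConvex.

(** * Differentiable convex functions *)

Section ConvexDifferentiable.
Local Open Scope classical_set_scope.
Context {R : realType} {n : nat}.
Variable f : 'rV[R]_n -> R.
Hypothesis df : forall x, differentiable f x.
Implicit Types (x y z u v w p q : 'rV[R]_n).

Lemma derive_grad x v : 'D_v f x = dotv (grad f x) v.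
Proof.
rewrite deriveE// {1}(row_sum_delta v) linear_sum; apply: eq_bigr => i _.
by rewrite linearZ /= mxE deriveE// mulrC.
Qed.

Lemma grad_le x v (c : R) :
  (forall t, 0 < t <= 1 -> f (x + t *: v) - f x <= t * c) ->
  dotv (grad f x) v <= c.
Proof.
move=> h; rewrite -derive_grad.
have dv : derivable f x v by exact: diff_derivable.
apply: (cvgr_to_le (cvg_dnbhs_at_right dv)).
near=> t.
have t0 : 0 < t by near: t; exact: nbhs_right_gt.
rewrite /= ler_pdivrMl// [_ + x]addrC; apply: h; rewrite t0/=.
by near: t; exact: nbhs_right_le.
Unshelve. all: by end_near. Qed.

Lemma grad_ge x v (c : R) :
  (forall t, 0 < t <= 1 -> t * c <= f (x + t *: v) - f x) ->
  c <= dotv (grad f x) v.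
Proof.
move=> h; rewrite -derive_grad.
have dv : derivable f x v by exact: diff_derivable.
apply: (cvgr_to_ge (cvg_dnbhs_at_right dv)).
near=> t.
have t0 : 0 < t by near: t; exact: nbhs_right_gt.
rewrite /= ler_pdivlMl// [_ + x]addrC; apply: h; rewrite t0/=.
by near: t; exact: nbhs_right_le.
Unshelve. all: by end_near. Qed.

(** A subgradient bounds every directional derivative from below; in the direction [p - grad f x]
    this makes a squared length nonpositive. *)
Lemma subgradient_grad x p :
  (forall z, f x + dotv p (z - x) <= f z) -> grad f x = p.
Proof.
move=> hp.
have /(_ (p - grad f x)) : forall v, dotv p v <= dotv (grad f x) v.
  move=> v; apply: grad_ge => t _; have := hp (x + t *: v).
  by rewrite [x + _]addrC addrK dotvZr -lerBrDl.
rewrite -subr_ge0 -dotvBl => h; apply/esym/eqP; rewrite -subr_eq0.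
apply: contraTT h => /dotvv_gt0; rewrite -ltNge !dotvBl; lra.
Qed.

Hypothesis convf : convex_fun f.

Definition gap x z := f z - (f x + dotv (grad f x) (z - x)).

Lemma gap_ge0 x z : 0 <= gap x z.
Proof.
rewrite subr_ge0 -lerBrDl; apply: grad_le => t /andP[t0 t1].
have := convf x z (t := t); rewrite (ltW t0) t1 => /(_ isT).
rewrite (_ : (1 - t) *: x + t *: z = x + t *: (z - x)).
  by move=> h; lra.
by rewrite scalerBl scale1r scalerBr addrAC addrA.
Qed.

Lemma gapxx x : gap x x = 0.
Proof. by rewrite /gap subrr dotv0r addr0 subrr. Qed.

Lemma gap_convex x u v t : 0 <= t <= 1 ->
  gap x ((1 - t) *: u + t *: v) <= (1 - t) * gap x u + t * gap x v.
Proof.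
move=> t01; have := convf u v t01; rewrite /gap !dotvBr dotvDr !dotvZr; lra.
Qed.

Lemma continuous_f : continuous f.
Proof. by move=> x; exact: differentiable_continuous. Qed.

Lemma continuous_gap x : continuous (gap x).
Proof.
move=> z; exact: (cvgB (@continuous_f z)
  (cvgD (cvg_cst (f x)) (@continuous_dotv_dist _ _ (grad f x) x z))).
Qed.

(** Changing the slope by [q] tilts the gap function by a linear term; the constant makes it vanish
    at [x']. *)
Lemma gap_shift x q x' z : grad f x' = grad f x + q ->
  gap x' z = gap x z - dotv q (z - x) - (gap x x' - dotv q (x' - x)).
Proof. by move=> e; rewrite /gap e !dotvDl !dotvBr; ring. Qed.

(** The two gaps between [x] and [x + w] add up to the right-hand side, and both are nonnegative. *)
Lemma gap_add_le x w : gap x (x + w) <= dotv (grad f (x + w) - grad f x) w.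
Proof.
have := gap_ge0 (x + w) x; rewrite /gap (_ : x - (x + w) = - w); last first.
  by rewrite opprD addrA subrr sub0r.
by rewrite [x + w - x]addrAC subrr add0r dotvNr dotvBl; lra.
Qed.

(* A tilted gap function that is positive outside a ball attains its minimum,
   where the gradient of [f] is the tilted slope. *)
Lemma slope_attained x q (M : R) :
  (forall z, M < `|z - x| -> 0 < gap x z - dotv q (z - x)) ->
  exists x', grad f x' = grad f x + q.
Proof.
move=> hM; pose h z := gap x z - dotv q (z - x).
have hx : h x = 0 by rewrite /h gapxx subrr dotv0r subrr.
have M0 : 0 <= M.
  by rewrite leNgt; apply/negP => M0; have := hM x; rewrite -/(h x) hx subrr normr0 ltxx => /(_ M0).
pose K := [set z | `|z - x| <= M].
have Kx : K x by rewrite /K/= subrr normr0.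
have cK : compact K.
  apply: bounded_closed_compact.
    exists (M + `|x|); split; first exact: num_real.
    move=> N MN z Kz; apply: (le_trans _ (ltW MN)).
    by rewrite -(subrK x z); apply: le_trans (ler_normD _ _) _; rewrite lerD2r.
  apply: (@closed_comp _ _ (fun z : 'rV[R]_n => `|z - x|) [set t | t <= M]).
    by move=> z _; exact: continuous_dist.
  exact: closed_le.
have ch : continuous h.
  by move=> z; exact: (cvgB (@continuous_gap x z) (@continuous_dotv_dist _ _ q x z)).
have [c _ hc] := compact_EVT_min (ex_intro _ x Kx) cK (continuous_subspaceT ch).
have {}hc z : h c <= h z.
  have [zM|Mz] := leP `|z - x| M; first by apply: hc; rewrite inE.
  apply: (@le_trans _ _ (h x)); first by apply: hc; rewrite inE.
  by rewrite hx ltW// hM.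
exists c; apply: subgradient_grad => z.
have := hc z; rewrite /h /gap dotvDl !dotvBr; lra.
Qed.

(** Contracting [z] towards [x] by the factor [1/(gap x z + 1)] brings the gap below 1, by
    convexity. *)
Lemma gap_growth x (L : R) : (forall y, gap x y <= 1 -> `|y - x| <= L) ->
  forall z, `|z - x| <= L * (gap x z + 1).
Proof.
move=> hL z; have g0 := gap_ge0 x z; set g := gap x z in g0 *.
have g1 : 0 < g + 1 by lra.
have t01 : 0 <= (g + 1)^-1 <= 1 by rewrite invr_ge0 ltW//= invf_le1//; lra.
have /hL : gap x ((1 - (g + 1)^-1) *: x + (g + 1)^-1 *: z) <= 1.
  apply: le_trans (gap_convex _ _ _ t01) _; rewrite gapxx mulr0 add0r -/g.
  by rewrite ler_pdivrMl//; lra.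
rewrite (_ : _ - x = (g + 1)^-1 *: (z - x)); last first.
  by apply/rowP => j; rewrite !mxE; ring.
by rewrite normrZ ger0_norm ?invr_ge0 ?(ltW g1)// ler_pdivrMl// mulrC.
Qed.

End ConvexDifferentiable.

(** * Variation of a convex function of one variable on a sublevel set *)

Section SublevelVariation.
Local Open Scope classical_set_scope.
Context {R : realType}.
Variables g g' : R -> R.
Hypothesis dg : forall t : R, is_derive t (1 : R) g (g' t).
Hypothesis cg' : continuous g'.
Let mu := @lebesgue_measure R.

Let continuous_g : continuous g.
Proof.
by move=> t; apply: differentiable_continuous; apply/derivable1_diffP; exact: ex_derive.
Qed.

Lemma integral_abs_derive (s u v : R) : u <= v ->
  (forall t, u < t < v -> `|g' t| = s * g' t) ->
  (\int[mu]_(t in `[u, v]) `|g' t|%:E = (s * (g v - g u))%:E)%E.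
Proof.
rewrite le_eqVlt => /predU1P[->|uv] hs.
  by rewrite subrr mulr0 set_itv1 integral_set1.
have mabs : continuous (fun t => `|g' t|).
  by move=> t; exact: (cvg_norm (@cg' t)).
have ms : continuous (fun t => s * g' t).
  by move=> t; exact: (cvgM (cvg_cst s) (@cg' t)).
rewrite integral_itv_bndoo; last first.
  apply/measurable_EFinP; apply: measurable_funTS.
  exact: continuous_measurable_fun.
under eq_integral.
  move=> t; rewrite inE/= in_itv/= => uvt; rewrite hs//; over.
rewrite -(@integral_itv_bndoo _ _ _ _ true false); last first.
  apply/measurable_EFinP; apply: measurable_funTS.
  exact: continuous_measurable_fun.
rewrite (@continuous_FTC2 _ _ (fun t => s * g t))//.
- by rewrite -EFinB -mulrBr.
- exact: continuous_subspaceT.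
- have cs : continuous (fun t => s * g t).
    by move=> t; exact: (cvgM (cvg_cst s) (@continuous_g t)).
  split.
  + by move=> t _; apply: derivableM.
  + by apply: cvg_at_right_filter; exact: cs.
  + by apply: cvg_at_left_filter; exact: cs.
- by move=> t _; rewrite derive1E; apply: derive_val.
Qed.

Hypothesis convg : forall s t, g s + g' s * (t - s) <= g t.

(** The sublevel set, compact thanks to [c] and [M], is empty or a segment. There [g] falls from at
    most [k] to a minimum that is at least 0 and rises again to at most [k]. *)
Lemma integral_abs_derive_sublevel (k c M : R) : 0 <= k -> (forall t, 0 <= g t) ->
  (forall t, g t <= k -> `|t - c| <= M) ->
  (\int[mu]_t (if g t <= k then `|g' t| else 0)%:E <= (2 * k)%:E)%E.
Proof.
move=> k0 g0 gM.
pose J := [set t | g t <= k].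
have [[t0 Jt0]|J0] := pselect (J !=set0); last first.
  under eq_integral => t _.
    rewrite ifF; last by apply/negP => gk; apply: J0; exists t.
    over.
  by rewrite integral0 lee_fin mulr_ge0.
have cJ : compact J.
  apply: (subclosed_compact _ (@segment_compact _ (c - M) (c + M))).
    apply: (@closed_comp _ _ g [set t | t <= k]); last exact: closed_le.
    by move=> t _; exact: continuous_g.
  by move=> t /gM; rewrite /= in_itv/= ler_distl.
have cid : {within J, continuous (id : R -> R)}.
  by apply: continuous_subspaceT => t; exact: cvg_id.
have [a Ja amin] := compact_EVT_min (ex_intro _ t0 Jt0) cJ cid.
have [b Jb bmax] := compact_EVT_max (ex_intro _ t0 Jt0) cJ cid.
rewrite inE in Ja; rewrite inE in Jb.
have ab : a <= b by apply: bmax; rewrite inE.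
have JE : J = `[a, b].
  apply/seteqP; split => t.
    by move=> Jt; rewrite /= in_itv/= amin ?bmax ?inE.
  rewrite /= in_itv/= => /andP[at_ tb]; rewrite /J/=.
  (* The tangent at [t] is compared with [g] at the endpoint towards which it does not decrease. *)
  have [gt0|gt0] := leP 0 (g' t).
    have := convg t b; have : 0 <= g' t * (b - t) by rewrite mulr_ge0// subr_ge0.
    by move: Jb; rewrite /J/=; lra.
  have := convg t a; have : 0 <= g' t * (a - t) by rewrite mulr_le0// ?subr_le0// ltW.
  by move: Ja; rewrite /J/=; lra.
have [m mab mmin] := EVT_min ab (continuous_subspaceT continuous_g).
move: (mab); rewrite in_itv/= => /andP[am mb].
have -> : (\int[mu]_t (if g t <= k then `|g' t| else 0)%:E =
    \int[mu]_(t in `[a, b]) `|g' t|%:E)%E.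
  rewrite [RHS]integral_mkcond; apply: eq_integral => t _.
  rewrite patchE -JE; case: ifPn => gk; first by rewrite mem_set.
  by rewrite memNset//; exact/negP.
have mabs (D : set R) : measurable_fun D (fun t => `|g' t|%:E).
  apply/measurable_EFinP; apply: measurable_funTS.
  by apply: continuous_measurable_fun => t; exact: (cvg_norm (@cg' t)).
have -> : (\int[mu]_(t in `[a, b]) `|g' t|%:E =
    \int[mu]_(t in `[a, m]) `|g' t|%:E + \int[mu]_(t in `[m, b]) `|g' t|%:E)%E.
  rewrite -[X in _ = (X + _)%E]integral_itv_bndo_bndc//.
  have -> : `[a, b]%classic = `[a, m[%classic `|` `[m, b]%classic.
    by rewrite -itv_bndbnd_setU// bnd_simp.
  apply: ge0_integral_setU => //; first exact: mabs.
  rewrite disj_set2E; apply/eqP/seteqP; split => // t [] /=.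
  by rewrite !in_itv/=; lra.
(* The tangent at [t], evaluated at the minimiser [m], lies below [g m <= g t]; this fixes the sign
   of [g' t] on either side of [m]. *)
rewrite (@integral_abs_derive (-1))//; last first.
  move=> t /andP[at_ tm]; rewrite mulN1r ler0_norm//.
  have := convg t m; have : g m <= g t by apply: mmin; rewrite in_itv/=; lra.
  move=> h1 h2; rewrite -(@pmulr_lle0 _ (m - t)) ?subr_gt0//; lra.
rewrite (@integral_abs_derive 1)//; last first.
  move=> t /andP[mt tb]; rewrite mul1r ger0_norm//.
  have := convg t m; have : g m <= g t by apply: mmin; rewrite in_itv/=; lra.
  move=> h1 h2; rewrite -(@pmulr_lge0 _ (t - m)) ?subr_gt0//.
  rewrite -opprB mulrN; lra.
rewrite -EFinD lee_fin; have := g0 m; move: Ja Jb; rewrite /J/=; lra.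
Qed.

End SublevelVariation.

(** * Surface area of slabs *)

Section LineDerivative.
Context {R : realType} {n : nat}.
Variable f : 'rV[R]_n -> R.
Hypothesis df : forall x, differentiable f x.

Lemma is_derive_line a v (t : R) :
  is_derive t (1 : R) (fun s : R => f (a + s *: v)) (dotv (grad f (a + t *: v)) v).
Proof.
have eqf : (fun h : R => h^-1 *: (((fun s : R => f (a + s *: v)) \o shift t) (h *: 1) -
    f (a + t *: v))) =
    (fun h : R => h^-1 *: ((f \o shift (a + t *: v)) (h *: v) - f (a + t *: v))).
  apply/funext => h /=; congr (_ *: (f _ - _)).
  by rewrite [h *: 1]mulr1 scalerDl addrCA.
have dv : derivable f (a + t *: v) v by exact: diff_derivable.
split; first by rewrite /derivable eqf.
by rewrite -derive_grad// /derive eqf.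
Qed.

Lemma upd_line z i (t : R) : upd z (i : 'I_n) t = upd z i 0 + t *: delta_mx 0 i.
Proof.
apply/rowP => j; rewrite !mxE eqxx /=; case: (eqVneq j i) => [->|ji].
  by rewrite eqxx mulr1 add0r.
by rewrite (negPf (_ : (j : nat) != i)) ?mulr0 ?addr0.
Qed.

Lemma is_derive_upd z (i : 'I_n) (t : R) :
  is_derive t (1 : R) (fun s : R => f (upd z i s)) (grad f (upd z i t) 0 i).
Proof.
have -> : (fun s : R => f (upd z i s)) = (fun s => f (upd z i 0 + s *: delta_mx 0 i)).
  by apply/funext => s; rewrite [upd z i s]upd_line.
rewrite [upd z i t]upd_line; apply: is_derive_eq; first exact: is_derive_line.
rewrite /dotv (bigD1 i)//= [delta_mx _ _ _ _]mxE !eqxx mulr1 big1 ?addr0// => j ji.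
by rewrite [delta_mx _ _ _ _]mxE (negPf ji) andbF mulr0.
Qed.

End LineDerivative.

Section SurfaceArea.
Local Open Scope classical_set_scope.
Context {R : realType} {n : nat}.
Variables (f : 'rV[R]_n -> R) (eta : R -> R).
Hypotheses (smoothf : smooth f) (convf : convex_fun f).
Hypothesis etaE : forall (x : 'rV[R]_n) (k : R), 0 < k ->
  (Sstar f x k * ((Wfun f x)^-1)%:E)%E = (eta k)%:E.
Implicit Types (x y z a : 'rV[R]_n).

Lemma smooth_differentiable x : differentiable f x.
Proof. exact: (smoothf [::]). Qed.
Let df := smooth_differentiable.

Lemma continuous_grad i : continuous (fun z => grad f z 0 i).
Proof.
under eq_fun do rewrite mxE.
by move=> z; exact: (differentiable_continuous (smoothf [:: delta_mx 0 i] z)).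
Qed.

Lemma continuous_Wfun : continuous (Wfun f).
Proof.
have cdot : continuous (fun z => dotv (grad f z) (grad f z)).
  apply: continuous_big => [|i _ y]; first exact: add_continuous.
  exact: (cvgM (@continuous_grad i y) (@continuous_grad i y)).
have c1 : continuous (fun z => 1 + dotv (grad f z) (grad f z)).
  by move=> z; have /= := cvgD (@cvg_cst _ (1 : R) _ (nbhs z) _) (cdot z); exact.
by move=> z; exact: (continuous_comp (c1 z) (@sqrt_continuous R _)).
Qed.

Lemma Wfun_ge1 x : 1 <= Wfun f x.
Proof. by rewrite -[leLHS]sqrtr1 ler_wsqrtr// lerDl dotvv_ge0. Qed.

Lemma Wfun_gt0 x : 0 < Wfun f x.
Proof. exact: lt_le_trans ltr01 (Wfun_ge1 x). Qed.

Lemma sqr_Wfun x : Wfun f x ^+ 2 = 1 + dotv (grad f x) (grad f x).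
Proof. by rewrite sqr_sqrtr// addr_ge0// dotvv_ge0. Qed.

Lemma Wfun_le x : Wfun f x <= 1 + n%:R * (`|grad f x| * `|grad f x|).
Proof.
apply: (@le_trans _ _ (Wfun f x ^+ 2)); first by rewrite expr2 ler_peMl ?Wfun_ge1// ltW// Wfun_gt0.
by rewrite sqr_Wfun lerD2l dotv_le.
Qed.

Definition slab x k z : \bar R := (if gap f x z <= k then Wfun f z else 0)%:E.

Lemma slab_ge0 x k z : (0 <= slab x k z)%E.
Proof. by rewrite lee_fin; case: ifP => // _; exact: ltW (Wfun_gt0 z). Qed.

Lemma coord_measurable_slab x k : coord_measurable (slab x k).
Proof.
apply: (@coord_measurable_if_le _ _ (gap f x) (Wfun f)).
  exact: continuous_gap.
exact: continuous_Wfun.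
Qed.

Lemma iint_slab x k : 0 < k -> iint n (slab x k) 0 = (eta k * Wfun f x)%:E.
Proof.
move=> k0; have <- : Sstar f x k = iint n (slab x k) 0.
  rewrite /Sstar /integral_Rn; congr (iint _ _ _); apply/funext => z.
  by rewrite -/(gap f x z) gap_ge0.
have W0 := Wfun_gt0 x; rewrite EFinM -(etaE x k0) -muleA -EFinM.
by rewrite mulVf ?gt_eqF// mule1.
Qed.

(** A point farther away would give the sublevel set volume at least [N * r ^+ n]. Since [W >= 1],
    its area would then exceed [eta 1 * Wfun f x]. *)
Lemma section_bounded x a r (N : nat) : 0 < r ->
  (forall z, `|z - a| <= r -> gap f x z <= 1) ->
  eta 1 * Wfun f x < N%:R * r ^+ n ->
  forall y, gap f x y <= 1 -> `|y - a| <= 2 * N%:R * r.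
Proof.
move=> r0 ra hN y y1; rewrite leNgt; apply/negP => far.
have : ((N%:R * r ^+ n)%:E <= iint n (slab x 1%R) 0%R)%E.
  apply: (@iint_long_convex _ _ _ (fun z => gap f x z <= 1) a y) => //.
  - exact: coord_measurable_slab.
  - exact: slab_ge0.
  - by move=> z z1; rewrite /slab z1 lee_fin Wfun_ge1.
  - move=> u v t t01 u1 v1; apply: le_trans (gap_convex convf _ _ _ t01) _.
    case/andP: t01 => t0 t1.
    have : (1 - t) * gap f x u <= (1 - t) * 1 by rewrite ler_wpM2l// subr_ge0.
    have : t * gap f x v <= t * 1 by rewrite ler_wpM2l.
    lra.
by rewrite iint_slab// lee_fin leNgt hN.
Qed.

Lemma gap_small_cube x : exists2 r : R, 0 < r &
  forall z, `|z - x| <= r -> gap f x z <= 1.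
Proof.
have /cvgr_lt/(_ 1) := @continuous_gap _ _ _ df x x.
rewrite gapxx => /(_ ltr01).
move/nbhs_normP => [e /= e0 he]; exists (e / 2); first by rewrite divr_gt0.
move=> z zx; apply/ltW/he; rewrite /= distrC; apply: le_lt_trans zx _.
by rewrite gtr_pMr//; lra.
Qed.

Lemma gap_growth_at x : exists2 L : R, 0 < L &
  forall z, `|z - x| <= L * (gap f x z + 1).
Proof.
have [r r0 hr] := gap_small_cube x.
pose N := (Num.truncn (eta 1 * Wfun f x / r ^+ n)).+1.
exists (2 * N%:R * r); first by rewrite !mulr_gt0// ltr0n.
apply: gap_growth => //; apply: section_bounded => //.
by rewrite -ltr_pdivrMr ?exprn_gt0// truncnS_gt.
Qed.

(** One small cube around [x] lies in all these slabs, and the integrand is at least 1 on it. *)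
Lemma eta_lower x : exists2 c : R, 0 < c & forall k, 1 <= k -> c <= eta k * Wfun f x.
Proof.
have [r r0 hr] := gap_small_cube x.
exists ((2 * r) ^+ n); first by rewrite exprn_gt0// mulr_gt0.
move=> k k1; rewrite -lee_fin -iint_slab ?(lt_le_trans ltr01 k1)//.
have := iint_cube_cst x 0 (ltW r0) ler01; rewrite mul1r => <-; apply: iint_le.
- by move=> z; rewrite lee_fin; case: ifP.
- exact: coord_measurable_cube_cst.
- exact: coord_measurable_slab.
- move=> z; rewrite /slab lee_fin; case: ifPn => zx.
    by rewrite ifT ?Wfun_ge1// (le_trans (hr _ zx)).
  by case: ifP => // _; exact: ltW (Wfun_gt0 z).
Qed.

Definition slab_partial x k i z : \bar R :=
  (if gap f x z <= k then `|grad f z 0 i - grad f x 0 i| else 0)%:E.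

Lemma slab_partial_ge0 x k i z : (0 <= slab_partial x k i z)%E.
Proof. by rewrite lee_fin; case: ifP. Qed.

Lemma coord_measurable_slab_partial x k i : coord_measurable (slab_partial x k i).
Proof.
apply: (@coord_measurable_if_le _ _ (gap f x) (fun z => `|grad f z 0 i - grad f x 0 i|)).
  exact: continuous_gap.
move=> z; exact: (cvg_norm (cvgB (@continuous_grad i z) (cvg_cst (grad f x 0 i)))).
Qed.

(** On a line parallel to axis [i] the left side is the variation of the gap function on its
    sublevel set, at most [2k]. The height [k / M] gives the cube the same integral on each line
    that meets it. *)
Lemma integral_slab_partial_upd x k M i z : 0 < k -> 0 < M ->
  (forall z, gap f x z <= k -> `|z - x| <= M) ->
  (\int[lebesgue_measure]_t slab_partial x k i (upd z i t) <=
   \int[lebesgue_measure]_t (if `|upd z i t - x| <= M then k / M else 0)%:E)%E.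
Proof.
move=> k0 M0 hM; have kM : 0 <= k / M by rewrite divr_ge0// ltW.
(* [b] says that the line meets the cube; otherwise it misses the sublevel set too. *)
pose b := [forall j, (j != i) ==> (`|z 0 j - x 0 j| <= M)].
have cubeE t : (`|upd z i t - x| <= M) = (`|t - x 0 i| <= M) && b.
  rewrite rV_norm_le ?(ltW M0)//; apply/forallP/andP => [h|[h1 /forallP h2] j].
    split; first by have := h i; rewrite !mxE eqxx.
    apply/forallP => j; apply/implyP => ji; have := h j.
    by rewrite !mxE (negPf (_ : (j : nat) != i)).
  rewrite !mxE; case: eqVneq => [ji|ji]; first by rewrite (_ : j = i)//; exact: val_inj.
  exact: (implyP (h2 j)).
have [bT|bF] := boolP b; last first.
  under eq_integral => t _.
    rewrite /slab_partial ifF; last first.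
      by apply/negP => /hM; rewrite cubeE (negPf bF) andbF.
    over.
  by rewrite integral0; apply: integral_ge0 => t _; rewrite lee_fin; case: ifP.
under [leRHS]eq_integral do rewrite cubeE bT andbT.
rewrite integral_segment ?(ltW M0)// (_ : 2 * M * (k / M) = 2 * k); last first.
  by field; rewrite gt_eqF.
pose p := grad f x.
have updB s t : upd z i t - upd z i s = (t - s) *: delta_mx 0 i.
  rewrite [upd z i t]upd_line [upd z i s]upd_line scalerBl.
  by rewrite opprD addrACA subrr add0r.
have dE s t : dotv p (upd z i t - x) = dotv p (upd z i s - x) + (t - s) * p 0 i.
  by rewrite -dotv_delta -dotvZr -updB !dotvBr; ring.
apply: (@integral_abs_derive_sublevel _ (fun t => gap f x (upd z i t))
  (fun t => grad f (upd z i t) 0 i - p 0 i) _ _ _ k (x 0 i) M) => //.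
- move=> t.
  have -> : (fun t => gap f x (upd z i t)) = (fun t => f (upd z i t)) -
      (cst (f x + dotv p (upd z i 0 - x)) + p 0 i \*: (@id R)).
    apply/funext => s; rewrite /gap -/p !fctE /cst /= (dE 0 s) subr0 addrA.
    by rewrite [p 0 i *: s]mulrC.
  have D := is_deriveB (is_derive_upd smooth_differentiable z i t)
    (is_deriveD (is_derive_cst (f x + dotv p (upd z i 0 - x)) t 1)
      (is_deriveZ (p 0 i) (is_derive_id t 1))).
  by apply: (is_derive_eq D); rewrite add0r [p 0 i *: 1]mulr1.
- move=> t; apply: cvgB; last exact: cvg_cst.
  have cu : continuous (fun t => upd z i t).
    under eq_fun => s do rewrite [upd z i s]upd_line.
    by move=> s; exact: (cvgD (cvg_cst (upd z i 0)) (@scalel_continuous _ _ (delta_mx 0 i) s)).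
  exact: (continuous_comp (cu t) (@continuous_grad i _)).
- move=> s t; have := gap_ge0 df convf (upd z i s) (upd z i t).
  rewrite /gap updB dotvZr dotv_delta -/p (dE s t); lra.
- exact: ltW.
- by move=> t; exact: gap_ge0.
- by move=> t /hM; rewrite cubeE => /andP[].
Qed.

(** The slope at [x] is split off because only the partial derivatives of the gap function have
    controlled variation. *)
Lemma Wfun_le_sum x z :
  Wfun f z <= 1 + \sum_i `|grad f x 0 i| + \sum_i `|grad f z 0 i - grad f x 0 i|.
Proof.
apply: (@le_trans _ _ (1 + \sum_i `|grad f z 0 i|)).
  have s0 : 0 <= \sum_i `|grad f z 0 i| by exact: sumr_ge0.
  rewrite -(@ler_pXn2r _ 2)// ?nnegrE ?(ltW (Wfun_gt0 _)) ?addr_ge0//.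
  rewrite sqr_Wfun sqrrD expr1n mul1r -addrA lerD2l.
  apply: ler_wpDl; first by rewrite mulrn_wge0.
  rewrite expr2 mulr_suml ler_sum// => i _.
  apply: (@le_trans _ _ (`|grad f z 0 i| * `|grad f z 0 i|)).
    by rewrite -normrM ler_norm.
  by rewrite ler_wpM2l// (bigD1 i)//= lerDl sumr_ge0.
rewrite -addrA lerD2l -big_split ler_sum// => i _ /=.
by rewrite -{1}(subrK (grad f x 0 i) (grad f z 0 i)) addrC ler_normD.
Qed.

(** The slab lies over a cube of half-side [M = L(k+1)]. The constant part contributes [P(2M)^n] and
    each partial derivative at most [(k/M)(2M)^n]; then [k/M <= 1/L] and, as [k >= 1],
    [2M <= 4Lk]. *)
Lemma eta_upper x : exists2 A : R, 0 < A & forall k, 1 <= k -> eta k * Wfun f x <= A * k ^+ n.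
Proof.
have [L L0 hL] := gap_growth_at x.
pose P := 1 + \sum_i `|grad f x 0 i|.
have P0 : 0 < P by rewrite ltr_pwDl// sumr_ge0.
exists ((P + n%:R / L) * (4 * L) ^+ n).
  by rewrite mulr_gt0 ?exprn_gt0 ?mulr_gt0// ltr_pwDl// divr_ge0// ltW.
move=> k k1; have k0 : 0 < k by exact: lt_le_trans k1.
pose M := L * (k + 1).
have M0 : 0 < M by rewrite mulr_gt0// addr_gt0.
have hM z : gap f x z <= k -> `|z - x| <= M.
  by move=> zk; apply: le_trans (hL z) _; rewrite ler_wpM2l ?(ltW L0)// lerD2r.
pose H0 z : \bar R := (if `|z - x| <= M then P else 0)%:E.
have H00 z : (0 <= H0 z)%E by rewrite lee_fin; case: ifP => // _; exact: ltW.
pose H1 z : \bar R := (\sum_(i < n) slab_partial x k i z)%E.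
have H10 z : (0 <= H1 z)%E by apply: sume_ge0 => i _; exact: slab_partial_ge0.
have mH1 : coord_measurable H1.
  by apply: coord_measurable_sum => i; exact: coord_measurable_slab_partial.
have mH0 : coord_measurable H0 by exact: coord_measurable_cube_cst.
have : (iint n (slab x k) 0 <= iint n (fun z => H0 z + H1 z) 0%R)%E.
  apply: iint_le.
  - exact: slab_ge0.
  - exact: coord_measurable_slab.
  - exact: coord_measurableD.
  move=> z; rewrite /slab; case: ifPn => zk; last by rewrite adde_ge0.
  rewrite /H0 hM// /H1 /slab_partial zk sumEFin -EFinD lee_fin.
  exact: Wfun_le_sum.
rewrite iintD// iint_slab// iint_cube_cst ?(ltW M0) ?(ltW P0)//.
rewrite (@iint_sum _ _ _ _ _ (fun i : 'I_n => slab_partial x k i)); last 2 first.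
- by move=> i z; exact: slab_partial_ge0.
- by move=> i; exact: coord_measurable_slab_partial.
have hi (i : 'I_n) : (iint n (slab_partial x k i) 0 <= (k / M * (2 * M) ^+ n)%:E)%E.
  rewrite -(iint_cube_cst x 0 (ltW M0)) ?divr_ge0 ?(ltW M0) ?(ltW k0)//.
  apply: (iint_le_slice (i := i)) => //.
  - by move=> z; exact: slab_partial_ge0.
  - by move=> z; rewrite lee_fin; case: ifP => // _; rewrite divr_ge0 ?(ltW M0) ?(ltW k0).
  - exact: coord_measurable_slab_partial.
  - exact: coord_measurable_cube_cst.
  - by move=> z; exact: integral_slab_partial_upd.
move=> h; have {h} := le_trans h (leeD (lexx _) (lee_sum _ (fun i _ => hi i))).
rewrite sumEFin -EFinD lee_fin sumr_const card_ord => h.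
apply: le_trans h _.
set X := (2 * M) ^+ n; set Y := k / M.
rewrite [leLHS](_ : _ = (P + n%:R * Y) * X); last first.
  rewrite [RHS]mulrDl; congr (_ + _).
  exact: etrans (esym (mulr_natl _ _)) (mulrA _ _ _).
rewrite -[leRHS]mulrA -exprMn {}/X {}/Y.
have kM : k / M <= L^-1.
  by rewrite ler_pdivrMr// /M mulKf ?gt_eqF// lerDl.
apply: ler_pM.
- by rewrite addr_ge0 ?(ltW P0)// mulr_ge0// divr_ge0 ?(ltW M0) ?(ltW k0).
- by rewrite exprn_ge0// mulr_ge0// ltW.
- by rewrite lerD2l ler_wpM2l.
- have Lk : L * 1 <= L * k by rewrite ler_pM2l.
  apply: lerXn2r; first by rewrite nnegrE mulr_ge0// ltW.
    by rewrite nnegrE !mulr_ge0// ltW.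
  rewrite /M; lra.
Qed.

End SurfaceArea.

(** * The two cases *)

Section Dichotomy.
Local Open Scope classical_set_scope.
Context {R : realType} {n : nat}.
Variables (f : 'rV[R]_n -> R) (eta : R -> R).
Hypotheses (smoothf : smooth f) (convf : convex_fun f).
Hypothesis etaE : forall (x : 'rV[R]_n) (k : R), 0 < k ->
  (Sstar f x k * ((Wfun f x)^-1)%:E)%E = (eta k)%:E.
Implicit Types (x y z a u v w p q : 'rV[R]_n).
Let df := smooth_differentiable smoothf.

Lemma superlinear_false x q : q != 0 ->
  (forall t : R, 0 <= t -> exists2 C : R, 0 <= C &
     forall z, t * `|dotv q (z - x)| <= gap f x z / 4 + C) -> False.
Proof.
move=> q0 hq; have qq := dotvv_gt0 q0.
have [L L0 hL] := gap_growth_at smoothf convf etaE x.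
have W0 := Wfun_gt0 f x; pose p := grad f x.
pose K := 2 ^+ n.+1 * Wfun f x.
(* With this [t] the quadratic term of [|p + t q|^2] absorbs the cross term and still exceeds
   [K^2]. *)
pose t := (K ^+ 2 + 2 * `|dotv p q|) / dotv q q + 1.
have t1 : 1 <= t.
  by rewrite lerDr divr_ge0 ?(ltW qq)// addr_ge0 ?sqr_ge0// mulr_ge0.
have t0 : 0 <= t by exact: le_trans t1.
have [C C0 hC] := hq t t0.
have {}hC z : dotv (t *: q) (z - x) <= gap f x z / 4 + C.
  by apply: le_trans (hC z); rewrite dotvZl ler_wpM2l// ler_norm.
have [x1 gx1] : exists x', grad f x' = grad f x + t *: q.
  (* Outside this ball the gap exceeds [2C], so three quarters of it exceed [C]. *)
  apply: (slope_attained df (M := L * (2 * C + 1))) => z Mz.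
  have := lt_le_trans Mz (hL z); rewrite ltr_pM2l// => h.
  by have := hC z; lra.
have Wx1 : K <= Wfun f x1.
  have K0 : 0 <= K by rewrite mulr_ge0 ?exprn_ge0// ltW.
  rewrite -(@ler_pXn2r _ 2) ?nnegrE ?K0 ?(ltW (Wfun_gt0 _ _))//.
  rewrite sqr_Wfun gx1 -/p !dotvDl !(dotvC _ (p + _)) !dotvDl !dotvZl !dotvZr (dotvC q p).
  have tqq : t * dotv q q = K ^+ 2 + 2 * `|dotv p q| + dotv q q.
    by rewrite /t mulrDl mul1r mulfVK// gt_eqF.
  have := dotvv_ge0 p; have := ler_norm (- dotv p q); rewrite normrN => h1 h2.
  have h3 : t * - dotv p q <= t * `|dotv p q| by rewrite ler_wpM2l.
  have h4 : 1 * (K ^+ 2 + dotv q q) <= t * (K ^+ 2 + dotv q q).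
    by rewrite ler_wpM2r// addr_ge0 ?sqr_ge0// ltW.
  have -> : t * (t * dotv q q) = t * (K ^+ 2 + dotv q q) + 2 * (t * `|dotv p q|).
    by rewrite tqq; ring.
  lra.
(* From [k0] on, [C <= k/2]; also [k0 >= 1], as the bounds on [eta] require. *)
pose k0 : R := 2 * C + 1.
have dbl (k : R) : k0 <= k -> 2 ^+ n.+1 * eta k <= eta (2 * k).
  move=> kk; have kp : 0 < k by apply: lt_le_trans kk; rewrite /k0; lra.
  have : (iint n (slab f x1 k) 0%R <= iint n (slab f x (2 * k)%R) 0%R)%E.
    apply: iint_le.
    - exact: slab_ge0.
    - exact: coord_measurable_slab.
    - exact: coord_measurable_slab.
    move=> z; rewrite /slab lee_fin; case: ifPn => [zk|_]; last first.
      by case: ifP => _; [exact: ltW (Wfun_gt0 _ _)|exact: lexx].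
    rewrite ifT; first exact: lexx.
    (* The gap at [x1], evaluated at [x], gives the sign of the constant in the tilt. Hence [3/4] of
       [gap f x z] is at most [k + C <= 3k/2]. *)
    have := gap_ge0 df convf x1 x.
    rewrite (gap_shift x gx1) gapxx subrr dotv0r => h.
    by move: zk; rewrite (gap_shift z gx1); have := hC z; move: kk; rewrite /k0; lra.
  rewrite !(iint_slab smoothf convf etaE) ?mulr_gt0// lee_fin => h.
  have e0 : 0 <= eta k.
    have [c c0 hc] := eta_lower smoothf convf etaE x.
    have k1 : 1 <= k by move: kk; rewrite /k0; lra.
    by rewrite -(pmulr_lge0 _ W0) (le_trans (ltW c0))// hc.
  rewrite -(ler_pM2r W0); apply: le_trans h.
  by rewrite mulrAC -/K mulrC ler_wpM2l.
have iter m : 2 ^+ n.+1 ^+ m * eta k0 <= eta (2 ^+ m * k0).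
  elim: m => [|m IH]; first by rewrite !expr0 !mul1r.
  rewrite [in leRHS]exprS -mulrA; apply: le_trans (dbl _ _).
    by rewrite exprS -mulrA ler_wpM2l// exprn_ge0.
  by rewrite ler_peMl// ?exprn_ege1// ?ler1n// /k0; lra.
have [A A0 hA] := eta_upper smoothf convf etaE x.
have [c c0 hc] := eta_lower smoothf convf etaE x.
have k01 : 1 <= k0 by rewrite /k0; lra.
(* At [2^m k0] the lower bound grows like [2^((n+1)m)] and the upper one like [2^(nm)]; cancelling
   leaves [2^m c], which is at least [m c]. *)
have bd m : m%:R * c <= A * k0 ^+ n.
  have m2 : 1 <= 2 ^+ m :> R by rewrite exprn_ege1// ler1n.
  have := hA (2 ^+ m * k0); rewrite mulr_ege1// => /(_ isT) h.
  have h2 : 2 ^+ n.+1 ^+ m * c <= A * (2 ^+ m * k0) ^+ n.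
    apply: le_trans h; apply: (@le_trans _ _ (2 ^+ n.+1 ^+ m * eta k0 * Wfun f x)).
      by rewrite -mulrA ler_wpM2l ?exprn_ge0// hc.
    by rewrite ler_pM2r.
  have {}h2 : 2 ^+ m * c <= A * k0 ^+ n.
    have pos : 0 < (2 ^+ m) ^+ n :> R by rewrite exprn_gt0// exprn_gt0.
    rewrite -(ler_pM2l pos); apply: le_trans (le_trans h2 _).
      by rewrite mulrA -exprSr -!exprM mulnC.
    by rewrite exprMn mulrCA.
  apply: le_trans h2; rewrite ler_wpM2r ?(ltW c0)//.
  by rewrite -natrX ler_nat ltnW// ltn_expl.
have := bd (Num.truncn (A * k0 ^+ n / c)).+1; rewrite leNgt => /negP; apply.
by rewrite -ltr_pdivrMr// truncnS_gt.
Qed.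

Lemma bounded_cone_false v r C : 0 < r -> v != 0 -> 0 <= C ->
  (forall x w, `|w - v| <= r -> dotv (grad f x) w <= C) -> False.
Proof.
move=> r0 v0 C0 hC; have vv := dotvv_gt0 v0; pose p0 := grad f 0.
have nv : 0 < `|v| by rewrite normr_gt0.
(* [T] bounds how far an attained slope can move from [p0] along [v], and [P] bounds all slopes on
   the way. *)
pose T := (C - dotv p0 v) / dotv v v.
have hT x t : grad f x = p0 + t *: v -> t <= T.
  move=> gx; have := hC x v; rewrite subrr normr0 => /(_ (ltW r0)).
  by rewrite gx dotvDl dotvZl ler_pdivlMr//; lra.
have T0 : 0 <= T by apply: (hT 0); rewrite scale0r addr0.
pose P := `|p0| + T * `|v|.
have P0 : 0 <= P by rewrite addr_ge0// mulr_ge0.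
(* For [w] within [r] of [v], [gap_add_le] bounds the gap at [x + s w] by [s] times the slope
   difference paired with [w], hence by 1. So the cube of radius [s r] at [x + s v] lies in the
   sublevel set. *)
pose s := (C + n%:R * (P * (`|v| + r)) + 1)^-1.
have s0 : 0 < s.
  by rewrite invr_gt0 ltr_wpDl// addr_ge0// !mulr_ge0// addr_ge0// ltW.
have e1 : 0 <= eta 1.
  have [c c0 hc] := eta_lower smoothf convf etaE 0.
  by rewrite -(pmulr_lge0 _ (Wfun_gt0 f 0)) (le_trans (ltW c0))// hc.
(* [W] is replaced by its bound in terms of [P], so that [N] and [L] serve all [x] with slope at
   most [P]. *)
pose N := (Num.truncn (eta 1 * (1 + n%:R * (P * P)) / (s * r) ^+ n)).+1.
pose L := 2 * N%:R * (s * r) + s * `|v|.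
have L0 : 0 < L by rewrite ltr_wpDl ?mulr_gt0// !mulr_ge0 ?ltW.
have bound x : `|grad f x| <= P -> forall y, gap f x y <= 1 -> `|y - x| <= L.
  move=> gP y y1.
  have : `|y - (x + s *: v)| <= 2 * N%:R * (s * r).
    apply: (section_bounded smoothf convf etaE (x := x)) y1; first exact: mulr_gt0.
    - move=> z hz; pose w := s^-1 *: (z - x).
      have zE : z = x + s *: w.
        by rewrite /w scalerA divff ?gt_eqF// scale1r addrC subrK.
      have wv : `|w - v| <= r.
        rewrite -(ler_pM2l s0) -{1}(gtr0_norm s0) -normrZ scalerBr.
        by apply: le_trans hz; rewrite {1}zE opprD addrA [x + _]addrC addrK.
      have wn : `|w| <= `|v| + r.
        rewrite -(subrK v w) addrC; apply: le_trans (ler_normD _ _) _.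
        by rewrite lerD2l.
      rewrite zE; apply: le_trans (gap_add_le df convf _ _) _.
      rewrite dotvZr -ler_pdivlMl// mulr1 invrK dotvBl.
      have := hC (x + s *: w) w wv.
      have : - dotv (grad f x) w <= n%:R * (P * (`|v| + r)).
        rewrite -dotvNl; apply: le_trans (dotv_le _ _) _.
        by rewrite ler_wpM2l// normrN ler_pM.
      lra.
    - rewrite -ltr_pdivrMr ?exprn_gt0 ?mulr_gt0//.
      apply: le_lt_trans (truncnS_gt _).
      rewrite ler_wpM2r ?invr_ge0 ?exprn_ge0 ?mulr_ge0 ?(ltW s0) ?(ltW r0)//.
      rewrite ler_wpM2l//; apply: le_trans (Wfun_le _ _) _.
      by rewrite lerD2l ler_wpM2l// ler_pM.
  move=> h; rewrite (_ : y - x = (y - (x + s *: v)) + s *: v); last first.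
    by rewrite opprD addrA subrK.
  apply: le_trans (ler_normD _ _) _; rewrite /L lerD//.
  by rewrite normrZ gtr0_norm.
(* The tilt by [tau v] then costs at most [|z - x| / (2L)], while beyond distance [2L] the gap
   exceeds this; [n.+1] makes the denominator visibly positive. *)
pose tau := (2 * (n.+1%:R * (L * `|v|)))^-1.
have tau0 : 0 < tau by rewrite invr_gt0 !mulr_gt0.
have step x : `|grad f x| <= P -> exists x', grad f x' = grad f x + tau *: v.
  move=> gP; apply: (slope_attained df (M := 2 * L)) => z Lz.
  have hL := gap_growth df convf (bound x gP) z.
  rewrite -(pmulr_rgt0 _ L0) mulrBr.
  suff : L * dotv (tau *: v) (z - x) <= `|z - x| / 2 by lra.
  rewrite dotvZl.
  apply: (@le_trans _ _ (L * (tau * (n.+1%:R * (`|v| * `|z - x|))))).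
    rewrite ler_wpM2l ?(ltW L0)// ler_wpM2l ?(ltW tau0)//.
    apply: le_trans (dotv_le _ _) _.
    by rewrite ler_wpM2r ?mulr_ge0// ler_nat.
  rewrite le_eqVlt; apply/orP; left; apply/eqP; rewrite /tau; field.
  by rewrite !gt_eqF.
have reach m : exists x, grad f x = p0 + (m%:R * tau) *: v.
  elim: m => [|m [x gx]]; first by exists 0; rewrite mul0r scale0r addr0.
  have [|x' gx'] := step x.
    rewrite gx; apply: le_trans (ler_normD _ _) _; rewrite lerD2l normrZ.
    rewrite ger0_norm ?mulr_ge0 ?(ltW tau0)// ler_wpM2r//.
    exact: hT gx.
  by exists x'; rewrite gx' gx -addrA -scalerDl -natr1 mulrDl mul1r.
have [x /hT] := reach (Num.truncn (T / tau)).+1.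
by rewrite leNgt -ltr_pdivrMr// truncnS_gt.
Qed.

End Dichotomy.

(** * Cluster points and spanning sets of directions *)

Section Directions.
Local Open Scope classical_set_scope.
Context {R : realType} {n : nat}.
Implicit Types (x y z u v w p q : 'rV[R]_n).

(** Compactness of the unit ball gives a cluster point; strict inequalities of continuous functions
    at it recur at arbitrarily late terms, which replaces a convergent subsequence. *)
Lemma bounded_seq_cluster (s : nat -> 'rV[R]_n) : (forall j, `|s j| <= 1) ->
  exists l, forall h : 'rV[R]_n -> R, continuous h -> forall c, c < h l ->
    forall J, exists2 j, (J <= j)%N & c < h (s j).
Proof.
move=> s1; pose K := [set z : 'rV[R]_n | `|z| <= 1].
have cK : compact K.
  apply: bounded_closed_compact.
    by exists 1; split => // N N1 z Kz; exact: le_trans Kz (ltW N1).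
  apply: (@closed_comp _ _ (fun z : 'rV[R]_n => `|z|) [set t | t <= 1]).
    by move=> z _; exact: norm_continuous.
  exact: closed_le.
have [l [_ cl]] := cK (s @ \oo) _ (filterS (fun j _ => s1 j) (@filterT _ \oo _)).
exists l => h ch c hc J.
have near_l : nbhs l [set z | c < h z].
  have := @cvgr_gt _ _ _ _ _ _ (ch l) c hc; exact.
have tailJ : (s @ \oo) [set s j | j in [set j | (J <= j)%N]].
  by exists J => // j Jj; exists j.
by have [_ [[j Jj <-] hj]] := cl _ _ tailJ near_l; exists j.
Qed.

(** Fewer than [n] rows leave a nonzero [q] orthogonal to all of them; a vector of [B] not
    orthogonal to [q] lies outside their span and is added. *)
Lemma spanning_rows (B : 'rV[R]_n -> Prop) :
  (forall q, q != 0 -> exists2 u, B u & dotv q u != 0) ->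
  exists2 A : 'M[R]_n, A \in unitmx & forall i, B (row i A).
Proof.
move=> hB.
suff H m : (m <= n)%N -> exists2 A : 'M[R]_(m, n), row_free A & forall i, B (row i A).
  by have [A rA BA] := H n (leqnn n); exists A => //; rewrite -row_free_unit.
elim: m => [|m IH] mn.
  by exists 0; [rewrite /row_free mxrank0|case].
have [A rA BA] := IH (ltnW mn).
have /rowV0Pn[q /sub_kermxP qA q0] : kermx A^T != 0.
  by rewrite -mxrank_eq0 mxrank_ker mxrank_tr (eqP rA) -lt0n subn_gt0.
have [u Bu qu] := hB q q0.
have {}qA : A *m q^T = 0 by rewrite -(trmxK A) -trmx_mul qA trmx0.
exists (col_mx u A).
  suff : forall w : 'rV_(1 + m), w *m col_mx u A = 0 -> w = 0 by exact: inj_row_free.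
  move=> w; rewrite -(hsubmxK w) mul_row_col.
  set a := lsubmx w; set b := rsubmx w => ab0.
  have aE : a = 0.
    have : (a *m u + b *m A) *m q^T = 0 by rewrite ab0 mul0mx.
    rewrite mulmxDl -(mulmxA b) qA mulmx0 addr0 -mulmxA => /rowP/(_ 0).
    rewrite !mxE big_ord1 (_ : (u *m q^T) 0 0 = dotv q u); last first.
      by rewrite mxE; apply: eq_bigr => i _; rewrite mxE mulrC.
    move=> /eqP; rewrite mulf_eq0 (negPf qu) orbF => /eqP a0.
    by apply/rowP => i; rewrite ord1 a0 mxE.
  move: ab0; rewrite aE mul0mx add0r => /eqP.
  by rewrite mulmx_free_eq0// => /eqP ->; rewrite row_mx0.
suff : forall i : 'I_(1 + m), B (row i (col_mx u A)) by [].
move=> i; case: (split_ordP i) => j ->; last by rewrite rowKd.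
by rewrite rowKu row_id.
Qed.

(** [v] is the sum of a basis of such directions. Vectors near [v] have coordinates in [[0, 2]] in
    this basis, so the upper bounds combine with nonnegative weights. *)
Lemma cone_with_interior (G : 'rV[R]_n -> Prop) : (0 < n)%N ->
  (forall q, q != 0 ->
     exists2 u, (exists C, forall g, G g -> dotv g u <= C) & dotv q u != 0) ->
  exists v r C, [/\ 0 < r, v != 0, 0 <= C &
    forall g w, G g -> `|w - v| <= r -> dotv g w <= C].
Proof.
move=> n0 /spanning_rows[A uA /choice[C hC]].
pose v : 'rV[R]_n := const_mx 1 *m A.
have vA : v *m invmx A = const_mx 1 by rewrite mulmxK.
(* A displacement of at most [1/(D+1)] changes each coordinate by at most 1. *)
pose D := \sum_i \sum_j `|invmx A i j|.
have D0 : 0 <= D by apply: sumr_ge0 => i _; exact: sumr_ge0.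
exists v, (D + 1)^-1, (\sum_i 2 * `|C i|); split.
- by rewrite invr_gt0 ltr_wpDl.
- apply/eqP => v0; have := vA; rewrite v0 mul0mx => /rowP/(_ (Ordinal n0)).
  by rewrite !mxE => /esym/eqP; rewrite oner_eq0.
- by apply: sumr_ge0 => i _; rewrite mulr_ge0.
move=> g w Gg wv; pose c := w *m invmx A.
have c1 i : `|c 0 i - 1| <= 1.
  have -> : c 0 i - 1 = ((w - v) *m invmx A) 0 i.
    by rewrite mulmxBl vA !mxE.
  rewrite mxE; apply: le_trans (ler_norm_sum _ _ _) _.
  apply: (@le_trans _ _ (\sum_j `|w - v| * `|invmx A j i|)).
    by apply: ler_sum => j _; rewrite normrM ler_wpM2r// coord_le_norm.
  rewrite -mulr_sumr; apply: (@le_trans _ _ ((D + 1)^-1 * D)).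
    rewrite ler_pM// ?sumr_ge0// ler_sum// => j _.
    by rewrite (bigD1 i)//= lerDl sumr_ge0.
  by rewrite ler_pdivrMl ?ltr_wpDl// mulr1 lerDl.
have -> : w = \sum_i c 0 i *: row i A.
  by rewrite -mulmx_sum_row mulmxKV.
have -> : dotv g (\sum_i c 0 i *: row i A) = \sum_i c 0 i * dotv g (row i A).
  elim/big_rec2: _ => [|i a b _ <-]; first by rewrite dotv0r.
  by rewrite dotvDr dotvZr.
apply: ler_sum => i _; have := c1 i; rewrite ler_norml => /andP[c_lo c_hi].
have ci0 : 0 <= c 0 i by lra.
apply: (@le_trans _ _ (c 0 i * `|C i|)).
  by rewrite ler_wpM2l// (le_trans (hC i g Gg))// ler_norm.
by rewrite ler_wpM2r//; lra.
Qed.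

End Directions.

(** * Directions of bounded slope *)

Section Recession.
Context {R : realType} {n : nat}.
Variable f : 'rV[R]_n -> R.
Hypotheses (df : forall x, differentiable f x) (convf : convex_fun f).

(* Normalizing points where [t * `|dotv q (z - x)|] beats [gap / 4] yields a
   direction along which [f] grows at most linearly. *)
Lemma recession_direction x q (t L : R) : 0 <= t -> 0 < L ->
  (forall z, `|z - x| <= L * (gap f x z + 1)) ->
  (forall C, 0 <= C -> exists z, gap f x z / 4 + C < t * `|dotv q (z - x)|) ->
  exists2 u, (exists C, forall y, dotv (grad f y) u <= C) & dotv q u != 0.
Proof.
move=> t0 L0 hL hz.
have /choice[z {}hz] : forall j : nat, exists z,
    gap f x z / 4 + j%:R < t * `|dotv q (z - x)| by move=> j; exact: hz.
pose d j := `|z j - x|; pose b := t * (n%:R * `|q|).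
have b0 : 0 <= b by rewrite mulr_ge0// mulr_ge0.
have tb j : t * `|dotv q (z j - x)| <= b * d j.
  by rewrite /b -!mulrA ler_wpM2l// normr_dotv.
have jd j : j%:R < b * d j.
  apply: le_lt_trans (lt_le_trans (hz j) (tb j)).
  by rewrite lerDr divr_ge0// gap_ge0.
have d0 j : 0 < d j.
  rewrite lt_neqAle normr_ge0 andbT; apply/eqP => dj.
  by have := jd j; rewrite -dj mulr0 ltNge ler0n.
have b_gt0 : 0 < b.
  by have := le_lt_trans (ler0n _ 0) (jd 0%N); rewrite pmulr_lgt0.
have dlarge (X : R) : exists J : nat, forall j, (J <= j)%N -> X < d j.
  exists (Num.truncn (b * X)).+1 => j Jj.
  rewrite -(ltr_pM2l b_gt0); apply: lt_trans (jd j).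
  by apply: lt_le_trans (truncnS_gt _) _; rewrite ler_nat.
pose s j := (d j)^-1 *: (z j - x).
have zs j : z j - x = d j *: s j.
  by rewrite /s scalerA divff ?scale1r// gt_eqF.
have s1 j : `|s j| <= 1.
  by rewrite /s normrZ ger0_norm ?invr_ge0 ?(ltW (d0 _))// mulVf// gt_eqF.
have [l hl] := bounded_seq_cluster s1.
exists l.
  (* The gap at [z j] is below [4 b d j]. Divided by [d j], the inequality [h2] bounds the slope
     difference along [s j] by [4b] plus a term that vanishes as [d j] grows. *)
  exists (dotv (grad f x) l + 4 * b) => y; rewrite leNgt; apply/negP => far.
  have {}far : 4 * b < dotv (grad f y - grad f x) l by rewrite dotvBl; lra.
  pose e := dotv (grad f y - grad f x) l - 4 * b.
  have e0 : 0 < e by rewrite subr_gt0.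
  have [J hJ] := dlarge (2 * gap f y x / e).
  have he : 4 * b + e / 2 < dotv (grad f y - grad f x) l by rewrite /e; lra.
  have [j Jj] := hl _ (@continuous_dotv _ _ _) _ he J.
  rewrite -(ltr_pM2l (d0 j)) -dotvZr -zs => h1.
  have h2 : dotv (grad f y - grad f x) (z j - x) <= gap f x (z j) + gap f y x.
    by have := gap_ge0 df convf y (z j); rewrite /gap dotvBl !dotvBr; lra.
  have h3 := lt_le_trans (hz j) (tb j).
  have := hJ j Jj; rewrite ltr_pdivrMr// => h4.
  have := ler0n R j; move: h1 h2 h3 h4; rewrite mulrDr -/(d j).
  set D := d j; set Gx := gap _ _ _; set Gy := gap _ _ _; set dd := dotv _ _.
  lra.
(* If [q] were orthogonal to [l], the gap at a late [z j] would be too small against [d j] for the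
   linear growth [hL]: both [L] and [L] times the gap fall below [d j / 2]. *)
apply/eqP => ql.
have t_gt0 : 0 < t.
  rewrite lt_neqAle t0 andbT; apply/eqP => te.
  by move: b_gt0; rewrite /b -te mul0r ltxx.
have [J hJ] := dlarge (2 * L).
have cq : continuous (fun w => - `|dotv q w|).
  by move=> w; exact: (cvgN (cvg_norm (@continuous_dotv _ _ q w))).
have he : - (8 * L * t)^-1 < - `|dotv q l|.
  by rewrite ltrN2 ql normr0 invr_gt0 !mulr_gt0.
have [j Jj] := hl _ cq _ he J; rewrite ltrN2 => h1.
have := hz j; rewrite zs dotvZr normrM (gtr0_norm (d0 j)) => h2.
have h3 := hL (z j); rewrite -/(d j) in h3.
have h4 := hJ j Jj.
have h5 : t * (d j * `|dotv q (s j)|) < d j / (8 * L).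
  rewrite mulrCA ltr_pM2l// -ltr_pdivlMl//.
  by apply: lt_le_trans h1 _; rewrite invfM mulrC.
have h6 : gap f x (z j) / 4 < d j / (8 * L).
  by apply: le_lt_trans (lt_trans h2 h5); rewrite lerDl.
have h7 : L * gap f x (z j) < d j / 2.
  move: h6; rewrite -(ltr_pM2l L0) (_ : L * (d j / (8 * L)) = d j / 8); last first.
    by field; rewrite gt_eqF.
  lra.
lra.
Qed.

End Recession.

(** * The dichotomy at the origin *)

Unset Implicit Arguments.
Set Strict Implicit.

Theorem theorem7 (R : realType) (n : nat) (hn : (1 <= n)%N)
    (f : 'rV[R]_n -> R) (hsmooth : smooth f) (hconv : convex_fun f) :
  ~ (exists eta : R -> R,
       (forall k : R, 0 < k -> 0 <= eta k) /\
       (forall (x : 'rV[R]_n) (k : R), 0 < k ->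
          (Sstar f x k * ((Wfun f x)^-1)%:E)%E = (eta k)%:E)).
Proof.
move=> [eta [_ etaE]]; have df := smooth_differentiable hsmooth.
have [L L0 hL] := gap_growth_at hsmooth hconv etaE 0.
case: (pselect (exists2 q : 'rV[R]_n, q != 0 & forall t : R, 0 <= t ->
    exists2 C : R, 0 <= C & forall z, t * `|dotv q (z - 0)| <= gap f 0 z / 4 + C)).
  by move=> [q q0 hq]; exact: (superlinear_false hsmooth hconv etaE q0 hq).
move=> not_superlinear.
(* Since no [q] is dominated for all [t], each nonzero [q] has a [t] for which every constant fails,
   and so yields a recession direction not orthogonal to it. *)
have [|v [r [C [r0 v0 C0 hC]]]] := @cone_with_interior R n (range (grad f)) hn.
  move=> q q0.
  have [t [t0 ht]] : exists t : R, 0 <= t /\ forall C, 0 <= C ->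
      exists z, gap f 0 z / 4 + C < t * `|dotv q (z - 0)|.
    apply: contra_notP not_superlinear => no_t; exists q => // t t0.
    apply: contra_notP no_t => no_C; exists t; split => // C C0.
    apply: contra_notP no_C => no_z; exists C => // z.
    by rewrite leNgt; apply/negP => zC; apply: no_z; exists z.
  have [u [C hC] qu] := recession_direction df hconv t0 L0 hL ht.
  by exists u => //; exists C => _ [y _ <-]; exact: hC.
apply: (bounded_cone_false hsmooth hconv etaE r0 v0 C0) => x w wv.
by apply: hC wv; exists x.
Qed.
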